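(* Let $\mathbf A=(A,\le,0,1)$ be a bounded MLUB-complete poset, let $(T,R)$ be a time frame with $R$ a serial binary relation, and let $P,F,H,G$ be the tense operators on $\mathbf A$ induced by $(T,R)$. Then $(P,G)$ and $(F,H)$ are dynamic pairs. That is, for each $(X,Y)\in\{(P,G),(F,H)\}$ and all $C,D\in\mathcal P_+(A^T)$: (T0) $Y(\mathbf 1)=\mathbf 1$ and $X(\mathbf 0)=\mathbf 0$, where $\mathbf 1,\mathbf 0\in A^T$ are the constant functions with values $1$ and $0$; (T1) if $C\le_1 D$ then $X(C)\le_2 X(D)$, and if $C\le_2 D$ then $Y(C)\le_1 Y(D)$; (T2) $C\le_1 (Y*X)(C)$ and $(X*Y)(C)\le_2 C$.
   Context: For a poset $(A,\le)$ and $X\subseteq A$: $L(X)=\{a\in A\mid a\le x \text{ for all } x\in X\}$, $U(X)=\{a\in A\mid x\le a\text{ for all }x\in X\}$; $\operatorname{Max}X$, $\operatorname{Min}X$ are the sets of maximal, resp. minimal, elements of $X$. The poset is MLUB-complete if for every nonempty $M\subseteq A$, every upper bound of $M$ lies above some minimal upper bound of $M$, and every lower bound of $M$ lies below some maximal lower bound of $M$. $\mathcal P_+(X)$ is the set of nonempty subsets of $X$; a singleton $\{a\}$ is identified with $a$. For subsets $X,Y$ of a poset: $X\le Y$ means $x\le y$ for all $x\in X,y\in Y$; $X\le_1Y$ means every $x\in X$ is below some $y\in Y$; $X\le_2Y$ means every $y\in Y$ is above some $x\in X$. A time frame is a pair $(T,R)$, $T$ a nonempty set, $R$ a binary relation on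 $T$; $R$ is serial if for each $s\in T$ there are $r,t\in T$ with $rRs$ and $sRt$. $A^T$ is ordered componentwise and all of $L,U,\operatorname{Max},\operatorname{Min},\le,\le_1,\le_2$ for subsets of $A^T$ refer to this order. Each $Z\in(\mathcal P_+A)^T$ is identified with the subset $\varphi(Z)=\{q\in A^T\mid q(t)\in Z(t)\text{ for all }t\}$ of $A^T$; comparisons involving such $Z$ and applications of operators to $Z$ are made via this identification. The tense operators induced by $(T,R)$ are the maps $P,F,H,G:\mathcal P_+(A^T)\to(\mathcal P_+A)^T$ defined for $B\in\mathcal P_+(A^T)$, $s\in T$ by $P(B)(s)=\operatorname{Min}U(\{q(t)\mid q\in B,\ tRs\})$, $F(B)(s)=\operatorname{Min}U(\{q(t)\mid q\in B,\ sRt\})$, $H(B)(s)=\operatorname{Max}L(\{q(t)\mid q\in B,\ tRs\})$, $G(B)(s)=\operatorname{Max}L(\{q(t)\mid q\in B,\ sRt\})$. For maps $X,Y:\mathcal P_+(A^T)\to(\mathcal P_+A)^T$, $X*Y=X\circ\varphi\circ Y$. *)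

(* Defs.v *)
From HB Require Import structures.
From mathcomp Require Import all_boot all_order.
From mathcomp Require Import boolp classical_sets.
Set Implicit Arguments.
Unset Strict Implicit.
Unset Printing Implicit Defensive.
Import Order.TTheory.
Local Open Scope classical_set_scope.
Local Open Scope order_scope.

Record nset (E : Type) := NSet { nset_set :> set E; nset_nonempty : nset_set !=set0 }.

Definition nset1 (E : Type) (a : E) : nset E :=
  NSet (ex_intro [set a] a erefl).

(* [L] and [U] are [lbound] and [ubound]. For subsets of [T -> A], [<=] is the
   componentwise order, i.e. the [porderType] instance on functions in boolp. *)
Section Poset.
Context (d : Order.disp_t) (E : porderType d).
Implicit Types X Y M : set E.

Definition Max X : set E := [set a | X a /\ forall b, X b -> a <= b -> b = a].
Definition Min X : set E := [set a | X a /\ forall b, X b -> b <= a -> b = a].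

Definition MLUB_complete : Prop := forall M, M !=set0 ->
  (forall u, ubound M u -> exists2 m, Min (ubound M) m & m <= u) /\
  (forall l, lbound M l -> exists2 m, Max (lbound M) m & l <= m).

Definition le1 X Y : Prop := forall x, X x -> exists2 y, Y y & x <= y.
Definition le2 X Y : Prop := forall y, Y y -> exists2 x, X x & x <= y.

End Poset.
Arguments MLUB_complete {d} E.

Definition serial (T : Type) (R : T -> T -> Prop) : Prop :=
  forall s, exists r t, R r s /\ R s t.

Section Identification.
Context (T A : Type).
Implicit Type Z : T -> nset A.

Lemma phi_nonempty Z : [set q : T -> A | forall t, nset_set (Z t) (q t)] !=set0.
Proof.
have [q qP] := choice (fun t => nset_nonempty (Z t)).
by exists q.
Qed.

Definition phi Z : nset (T -> A) := NSet (phi_nonempty Z).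

Definition star (X Y : nset (T -> A) -> T -> nset A) :
  nset (T -> A) -> T -> nset A := fun B => X (phi (Y B)).

End Identification.

Section TenseOperators.
Context (d : Order.disp_t) (A : tbPOrderType d) (T : Type) (R : T -> T -> Prop).
Implicit Types (B : nset (T -> A)) (s : T).

Definition past_values B s : set A :=
  [set a | exists q t, [/\ nset_set B q, R t s & a = q t]].
Definition future_values B s : set A :=
  [set a | exists q t, [/\ nset_set B q, R s t & a = q t]].

Hypotheses (mlubA : MLUB_complete A) (serR : serial R).

Lemma past_values_nonempty B s : past_values B s !=set0.
Proof.
have [q Bq] := nset_nonempty B; have [r [_ [Rrs _]]] := serR s.
by exists (q r), q, r.
Qed.

Lemma future_values_nonempty B s : future_values B s !=set0.
Proof.
have [q Bq] := nset_nonempty B; have [_ [t [_ Rst]]] := serR s.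
by exists (q t), q, t.
Qed.

Lemma Min_ubound_nonempty (M : set A) : M !=set0 -> Min (ubound M) !=set0.
Proof.
move=> /mlubA[+ _] => /(_ \top)[a _|m mM _]; first exact: lex1.
by exists m.
Qed.

Lemma Max_lbound_nonempty (M : set A) : M !=set0 -> Max (lbound M) !=set0.
Proof.
move=> /mlubA[_] /(_ \bot)[a _|m mM _]; first exact: le0x.
by exists m.
Qed.

Definition tenseP B s : nset A :=
  NSet (Min_ubound_nonempty (past_values_nonempty B s)).
Definition tenseF B s : nset A :=
  NSet (Min_ubound_nonempty (future_values_nonempty B s)).
Definition tenseH B s : nset A :=
  NSet (Max_lbound_nonempty (past_values_nonempty B s)).
Definition tenseG B s : nset A :=
  NSet (Max_lbound_nonempty (future_values_nonempty B s)).

End TenseOperators.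

Definition dynamic_pair (d : Order.disp_t) (A : tbPOrderType d) (T : Type)
    (X Y : nset (T -> A) -> T -> nset A) : Prop :=
  let one : T -> A := fun=> \top in
  let zero : T -> A := fun=> \bot in
  [/\ phi (Y (nset1 one)) = nset1 one /\ phi (X (nset1 zero)) = nset1 zero,
      forall C D : nset (T -> A),
        (le1 C D -> le2 (phi (X C)) (phi (X D))) /\
        (le2 C D -> le1 (phi (Y C)) (phi (Y D)))
    & forall C : nset (T -> A),
        le1 C (phi (star Y X C)) /\ le2 (phi (star X Y C)) C].

(* Main.v *)
Require Import Defs.
From HB Require Import structures.
From mathcomp Require Import all_boot all_order.
From mathcomp Require Import boolp classical_sets.

(** Everything rests on one observation: if [R s t], then [q s] is below every
    upper bound of the past values at [t] and [q t] is above every lower bound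
    of the future values at [s]; MLUB-completeness then supplies, pointwise, the
    extremal bounds.  The pair [(F, H)] is [(P, G)] for the converse of [R]. *)

Set Implicit Arguments.
Unset Strict Implicit.
Unset Printing Implicit Defensive.
Import Order.TTheory.
Local Open Scope classical_set_scope.
Local Open Scope order_scope.

(** The equations of (T0) compare records, so proof irrelevance must identify the nonemptiness
    witnesses. *)
Lemma nset_ext (E : Type) (X Y : nset E) : nset_set X = nset_set Y -> X = Y.
Proof. by case: X Y => [X hX] [Y hY] /= eXY; subst Y;
  rewrite (Prop_irrelevance hX hY). Qed.

Section Bounds.
Context (d : Order.disp_t) (A : tbPOrderType d).
Implicit Types M : set A.

(** For (T0): [\bot] is itself an upper bound here, so minimality forces every minimal one to equal
    it. *)
Lemma Min_ubound_bot M : (forall a, M a -> a = \bot) -> Min (ubound M) = [set \bot].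
Proof.
move=> M0; have ub0 : ubound M \bot by move=> a /M0->.
apply/seteqP; split => [a [_ /(_ _ ub0 (le0x a)) <-]//|_ ->].
by split=> // b _; rewrite lex0 => /eqP.
Qed.

Lemma Max_lbound_top M : (forall a, M a -> a = \top) -> Max (lbound M) = [set \top].
Proof.
move=> M1; have lb1 : lbound M \top by move=> a /M1->.
apply/seteqP; split => [a [_ /(_ _ lb1 (lex1 a)) <-]//|_ ->].
by split=> // b _; rewrite le1x => /eqP.
Qed.

Context (T : Type).
Implicit Types (Z : T -> nset A) (q : T -> A).

Lemma phi_eq1 Z q : (forall s, nset_set (Z s) = [set q s]) -> phi Z = nset1 q.
Proof.
move=> ZE; apply: nset_ext; apply/seteqP; split => [r /= rZ|_ -> s]; last by rewrite ZE.
by apply/funext => s; have := rZ s; rewrite ZE.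
Qed.

(** The order on functions is componentwise and [phi Z] is a full product, so choosing one bound at
    each [s] gives the required function. *)
Lemma phi_above Z q : (forall s, exists2 a, nset_set (Z s) a & q s <= a) ->
  exists2 r, nset_set (phi Z) r & q <= r.
Proof.
move=> qZ; have [r rP] := choice (fun s => let: ex_intro2 a Za qa := qZ s in
  ex_intro (fun a => nset_set (Z s) a /\ q s <= a) a (conj Za qa)).
by exists r; [move=> s; case: (rP s)|apply/lefP => s; case: (rP s)].
Qed.

Lemma phi_below Z q : (forall s, exists2 a, nset_set (Z s) a & a <= q s) ->
  exists2 r, nset_set (phi Z) r & r <= q.
Proof.
move=> qZ; have [r rP] := choice (fun s => let: ex_intro2 a Za qa := qZ s in
  ex_intro (fun a => nset_set (Z s) a /\ a <= q s) a (conj Za qa)).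
by exists r; [move=> s; case: (rP s)|apply/lefP => s; case: (rP s)].
Qed.

End Bounds.

(** [X] and [Y] enter only through their underlying sets, so that the same statement serves [R] and
    its converse. *)
Lemma dynamic_pair_past_future (d : Order.disp_t) (A : tbPOrderType d)
    (mlubA : MLUB_complete A) (T : Type) (R : T -> T -> Prop) (serR : serial R)
    (X Y : nset (T -> A) -> T -> nset A) :
    (forall B s, nset_set (X B s) = Min (ubound (past_values R B s))) ->
    (forall B s, nset_set (Y B s) = Max (lbound (future_values R B s))) ->
  dynamic_pair X Y.
Proof.
move=> XE YE.
have minP B s u : ubound (past_values R B s) u -> exists2 a, nset_set (X B s) a & a <= u.
  by rewrite XE; apply: (mlubA _ (past_values_nonempty serR B s)).1.
have maxP B s l : lbound (future_values R B s) l -> exists2 a, nset_set (Y B s) a & l <= a.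
  by rewrite YE; apply: (mlubA _ (future_values_nonempty serR B s)).2.
have XP B p q s t : nset_set (phi (X B)) p -> nset_set B q -> R s t -> q s <= p t.
  by move=> /(_ t); rewrite XE => -[+ _] Bq Rst; apply; exists q, s.
have YP B p q s t : nset_set (phi (Y B)) p -> nset_set B q -> R s t -> p s <= q t.
  by move=> /(_ s); rewrite YE => -[+ _] Bq Rst; apply; exists q, t.
split=> [|C D|C]; split.
- apply: phi_eq1 => s; rewrite YE; apply: Max_lbound_top => a.
  by move=> [_ [t [-> _ ->]]].
- apply: phi_eq1 => s; rewrite XE; apply: Min_ubound_bot => a.
  by move=> [_ [t [-> _ ->]]].
(* (T1): [r s] bounds the past values of [C] from above, since each [q] in [C] lies under some [q']
   in [D]. *)
- move=> CD r rD; apply: phi_below => s; apply: minP => _ [q [t [Cq Rts ->]]].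
  have [q' Dq' /lefP qq'] := CD q Cq.
  exact: le_trans (qq' t) (XP _ _ _ _ _ rD Dq' Rts).
- move=> CD r rC; apply: phi_above => s; apply: maxP => _ [q [t [Dq Rst ->]]].
  have [q' Cq' /lefP qq'] := CD q Dq.
  exact: le_trans (YP _ _ _ _ _ rC Cq' Rst) (qq' t).
(* (T2): [q s] is a lower bound of the future values at [s] of all [p] in [phi (X C)], hence lies
   below a maximal one. *)
- move=> q Cq; apply: phi_above => s; apply: maxP => _ [p [t [pC Rst ->]]].
  exact: XP pC Cq Rst.
- move=> q Cq; apply: phi_below => s; apply: minP => _ [p [t [pC Rts ->]]].
  exact: YP pC Cq Rts.
Qed.

Theorem theorem3p20 (d : Order.disp_t) (A : tbPOrderType d)
    (mlubA : MLUB_complete A) (T : Type) (inhT : inhabited T)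
    (R : T -> T -> Prop) (serR : serial R) :
  dynamic_pair (tenseP mlubA serR) (tenseG mlubA serR) /\
  dynamic_pair (tenseF mlubA serR) (tenseH mlubA serR).
Proof.
split; first exact: (dynamic_pair_past_future mlubA serR).
have serRV : serial (fun s t => R t s).
  by move=> s; have [r [t [Rrs Rst]]] := serR s; exists t, r.
(* Past values for the converse relation are by conversion the future values for [R], and vice
   versa. *)
exact: (dynamic_pair_past_future mlubA serRV).
Qed.
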